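(* Let $1<a\le b$ be integers and let $I\in\mathcal I_{a,b}$ with $I\ne(x^a,y^b)$. (a) Let $L_1,L_2\in\mathcal I_{a,b}$ be monomial ideals such that $I\subseteq L_1$, $I\subseteq L_2$ and $r(L_1)=r(L_2)=1$. Then $r(L_1\cap L_2)=1$. (b) There exists a unique monomial ideal $L\in\mathcal I_{a,b}$ with $I\subseteq L$ and $r(L)=1$ and such that $r(L')>1$ for all monomial ideals $L'$ with $I\subseteq L'\subsetneq L$.
   Context: $K$ is a field. For a monomial ideal $I\subset K[x,y]$, $G(I)$ is its unique minimal set of monomial generators. $\mathcal I_{a,b}$ is the set of monomial ideals $I\subset K[x,y]$ with $x^a,y^b\in G(I)$ and $bc+ad\ge ab$ for all $x^cy^d\in G(I)$. For $I\in\mathcal I_{a,b}$ and $J=(x^a,y^b)$, the reduction number $r(I)$ is the smallest integer $r\ge0$ with $I^{r+1}=JI^r$ (such $r$ exists). The ideals $L_1\cap L_2$ and $L'$ occurring in the statement again belong to $\mathcal I_{a,b}$. *)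

(* Defs.v *)
From HB Require Import structures.
From mathcomp Require Import all_boot all_order all_algebra.
From mathcomp Require Import boolp classical_sets.
From mathcomp Require Import mpoly.

Set Implicit Arguments.
Unset Strict Implicit.
Unset Printing Implicit Defensive.

Import Order.TTheory GRing.Theory.
Local Open Scope ring_scope.
Local Open Scope classical_set_scope.

Section Ideals.
Variable R : comNzRingType.
Implicit Types I J S : set R.

(* Unlike [idealr_closed] of MathComp, the unit ideal is allowed. *)
Definition is_ideal I : Prop :=
  [/\ I 0, forall p q, I p -> I q -> I (p + q) & forall r p, I p -> I (r * p)].

Definition ideal_gen S : set R := smallest is_ideal S.

Definition ideal_mul I J : set R := ideal_gen [set p * q | p in I & q in J].

Definition ideal_exp I (n : nat) : set R := iter n (ideal_mul I) setT.

End Ideals.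

Section MonomialIdeals.
Variable K : fieldType.
Implicit Types (I : set {mpoly K[2]}) (G S : set {mpoly K[2]}).

Definition vx : {mpoly K[2]} := 'X_ord0.
Definition vy : {mpoly K[2]} := 'X_ord_max.

Definition monomials : set {mpoly K[2]} :=
  [set p | exists c d : nat, p = vx ^+ c * vy ^+ d].

Definition monomial_gens I S : Prop := S `<=` monomials /\ I = ideal_gen S.

Definition monomial_ideal I : Prop := exists S, monomial_gens I S.

Definition minimal_monomial_gens I G : Prop :=
  monomial_gens I G /\ forall S, monomial_gens I S -> S `<=` G -> S = G.

(* G(I); every monomial ideal has exactly one minimal set of monomial
   generators, so that the default value [set0] is only used for ideals which
   are not monomial. *)
Definition mingens I : set {mpoly K[2]} :=
  xget set0 [set G | minimal_monomial_gens I G].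

Definition Iab (a b : nat) : set (set {mpoly K[2]}) :=
  [set I | [/\ monomial_ideal I,
               mingens I (vx ^+ a),
               mingens I (vy ^+ b) &
               forall c d : nat, mingens I (vx ^+ c * vy ^+ d) ->
                 (a * b <= b * c + a * d)%N]].

Definition Jab (a b : nat) : set {mpoly K[2]} :=
  ideal_gen [set vx ^+ a; vy ^+ b].

Definition reduction_eq (a b : nat) I (r : nat) : Prop :=
  ideal_exp I r.+1 = ideal_mul (Jab a b) (ideal_exp I r).

Definition is_reduction_number (a b : nat) I (r : nat) : Prop :=
  reduction_eq a b I r /\ forall s : nat, reduction_eq a b I s -> (r <= s)%N.

(* The default value 0 is taken when no [r] satisfies the equation; hence
   [reduction_number a b I = 1] and [1 < reduction_number a b I] both entail
   that such an [r] exists. *)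
Definition reduction_number (a b : nat) I : nat :=
  xget 0%N [set r | is_reduction_number a b I r].

End MonomialIdeals.

(* Main.v *)
Require Import Defs.
From mathcomp Require Import all_boot all_order all_algebra.
From mathcomp Require Import boolp classical_sets.
From mathcomp Require Import mpoly.
From mathcomp Require Import zify.

Local Open Scope classical_set_scope.

(** A monomial ideal is determined by the upward closed set [E] of exponents of
its monomials ([mideal]), and products of monomial ideals become sumsets of
exponents ([midealM]).  Write [ea = (a, 0)] and [eb = (0, b)].  Minimal
generators being the minimal exponents, the class I_(a,b) consists of the
upward closed [E] that contain [ea] and [eb] and lie on or above the line
through these two points ([IabP]).

The equation I^2 = J I says that each sum [p + q] of two elements of [E] lies
in [ea + E] or in [eb + E] ([sums_reduce]).  This property passes to
intersections of nonempty families ([sums_reduce_bigcap]).  Indeed, if both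
[ea] and [eb] can be subtracted from [p + q], then [p + q - ea] is still above
[eb], so it lies in every member of the family.  Otherwise only one of the two
can be subtracted, and it is the same one for all members.  As I differs from
J = (x^a, y^b), the reduction number of an ideal of the class above I is never
0, so that being 1 amounts to [sums_reduce]; this gives (a).

For (b), the ideal L is the intersection of all ideals of reduction number 1 of
the class that contain I.  There is at least one: all exponents on or above the
line ([sums_reduce_halfplane]).  An ideal L' with I <= L' < L is again in the
class, its reduction number is neither 0, by the same argument, nor 1, since L
is the least ideal of reduction number 1.  It remains to see that L' has a
reduction number at all ([reduction_eq_exists]).  In a long sum of exponents of
[E], either some term is above [ea] or [eb], or all terms lie in the box
[0, a) x [0, b) and some [x] among them occurs at least [a b] times.  In the
second case [a b x = (b x_0) ea + (a x_1) eb], with at least [a b] terms on the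
right since [x] is above the line, so that a vertex can be split off. *)

(** * Sets of exponents and their sums *)

Section Sumsets.
Set Implicit Arguments.
Unset Strict Implicit.
Unset Printing Implicit Defensive.
Variable n : nat.
Implicit Types (E F G A : set 'X_{1..n}) (m k : 'X_{1..n}).

Definition upset E : Prop := forall m k, E m -> E (m + k)%MM.

Definition sumset E F : set 'X_{1..n} := [set (x + y)%MM | x in E & y in F].

(** The exponents of the r-th power; the 0-th power is the unit ideal, which has
    all exponents. *)
Definition nsumset E (r : nat) : set 'X_{1..n} := iter r (sumset E) setT.

Definition minimal E : set 'X_{1..n} :=
  [set m | E m /\ forall k, E k -> (k <= m)%MM -> k = m].

Lemma upset_le {E m k} : upset E -> E m -> (m <= k)%MM -> E k.
Proof. by move=> uE Em /submK <-; rewrite addmC; apply: uE. Qed.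

Lemma sumset_upset E F : upset F -> upset (sumset E F).
Proof.
move=> uF _ k [x Ex [y Fy <-]]; exists x => //; exists (y + k)%MM; first exact: uF.
by rewrite addmA.
Qed.

Lemma sumset_sub {A E F G} : A `<=` E -> F `<=` G -> sumset A F `<=` sumset E G.
Proof. by move=> AE FG _ [x /AE Ex [y /FG Gy <-]]; exists x => //; exists y. Qed.

Lemma sumsetA E F G : sumset (sumset E F) G = sumset E (sumset F G).
Proof.
apply/seteqP; split=> [_ [_ [x Ex [y Fy <-]] [z Gz <-]]|_ [x Ex [_ [y Fy [z Gz <-]] <-]]].
  by exists x => //; exists (y + z)%MM; [exists y => //; exists z|rewrite addmA].
by exists (x + y)%MM; [exists x => //; exists y|exists z; rewrite ?addmA].
Qed.

Lemma sumsetT E : upset E -> sumset E setT = E.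
Proof.
move=> uE; apply/seteqP; split=> [_ [x Ex [y _ <-]]|m Em]; first exact: uE.
by exists m => //; exists 0%MM; rewrite ?addm0.
Qed.

Lemma sumTset F : upset F -> sumset setT F = F.
Proof.
move=> uF; apply/seteqP; split=> [_ [x _ [y Fy <-]]|m Fm].
  by rewrite addmC; apply: uF.
by exists 0%MM => //; exists m; rewrite // addmC addm0.
Qed.

Lemma nsumset_upset E r : upset (nsumset E r).
Proof. by case: r => [//|r]; elim: r => [|r IH]; apply: sumset_upset. Qed.

Lemma nsumset1 E : upset E -> nsumset E 1 = E.
Proof. exact: sumsetT. Qed.

Lemma nsumset2 E : upset E -> nsumset E 2 = sumset E E.
Proof. by move=> uE; rewrite /nsumset /= sumsetT. Qed.

Lemma nsumsetS_sub E r : nsumset E r.+1 `<=` nsumset E r.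
Proof.
move=> _ [x Ex [y Ey <-]]; rewrite addmC; exact: nsumset_upset.
Qed.

Lemma nsumset_sub E r s : (s <= r)%N -> nsumset E r `<=` nsumset E s.
Proof.
move=> /subnK <-; elim: (r - s)%N => [//|d IH].
by apply: subset_trans IH; apply: nsumsetS_sub.
Qed.

Lemma nsumsetD {E r s x y} :
  nsumset E r x -> nsumset E s y -> nsumset E (r + s) (x + y)%MM.
Proof.
elim: r x => [|r IH] x.
  by move=> _ Ey; rewrite addmC; apply: nsumset_upset.
move=> [u Eu [v Ev <-]] Ey; exists u => //; exists (v + y)%MM; first exact: IH.
by rewrite addmA.
Qed.

Lemma nsumsetMn {E x} r : E x -> nsumset E r (x *+ r)%MM.
Proof.
by move=> Ex; elim: r => [//|r IH]; exists x => //; exists (x *+ r)%MM; rewrite ?mulmS.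
Qed.

Definition msum (s : seq 'X_{1..n}) : 'X_{1..n} := foldr (fun x y => x + y)%MM 0%MM s.

Lemma msum_cat s t : msum (s ++ t) = (msum s + msum t)%MM.
Proof. by elim: s => [|x s /= ->]; rewrite ?addmA // addmC addm0. Qed.

Lemma msum_nseq r x : msum (nseq r x) = (x *+ r)%MM.
Proof. by elim: r => [|r /= ->]; rewrite ?mulm0n ?mulmS. Qed.

Lemma msum_perm s t : perm_eq s t -> msum s = msum t.
Proof.
have E (u : seq 'X_{1..n}) : msum u = (\big[+%MM/0%MM]_(x <- u) x).
  by elim: u => [|x u /= ->]; rewrite ?big_nil ?big_cons.
by move=> st; rewrite !E; apply: perm_big.
Qed.

Lemma nsumset_msum E s : (forall x, x \in s -> E x) -> nsumset E (size s) (msum s).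
Proof.
elim: s => [//|x s IH] H; exists x; first by apply: H; rewrite inE eqxx.
by exists (msum s) => //; apply: IH => y ys; apply: H; rewrite inE ys orbT.
Qed.

Lemma nsumsetP E r m : nsumset E r m ->
  exists s t, [/\ size s = r, forall x, x \in s -> E x & m = (msum s + t)%MM].
Proof.
elim: r m => [|r IH] m; first by exists [::], m; rewrite addmC addm0.
move=> [x Ex [y /IH[s [t [<- Es ->]]] <-]]; exists (x :: s), t; split=> //.
  by move=> z; rewrite inE => /orP[/eqP->|/Es].
by rewrite addmA.
Qed.

(** The exponents are well-founded for divisibility, the total degree being a
    measure. *)
Lemma minimal_below {E m} : E m -> exists2 k, minimal E k & (k <= m)%MM.
Proof.
move: {2}(mdeg m).+1 (ltnSn (mdeg m)) => d; elim: d m => [//|d IH] m md Em.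
have [mE|] := pselect (minimal E m); first by exists m => //; apply: lepm_refl.
move=> /not_andP[//|/existsNP[k /not_implyP[Ek /not_implyP[km nkm]]]].
have [] := IH k _ Ek; last first.
  by move=> l El lk; exists l => //; apply: lepm_trans lk km.
move: nkm md; rewrite -{1 2}(submK km) mdegD.
have [->|] := eqVneq (m - k)%MM 0%MM; first by rewrite addmC addm0.
rewrite -mdeg_eq0; lia.
Qed.

End Sumsets.

(** * Monomial ideals as sets of exponents *)

Section MonomialIdealsOfExponents.
Set Implicit Arguments.
Unset Strict Implicit.
Variables (n : nat) (K : fieldType).
Implicit Types (E F A : set 'X_{1..n}) (m : 'X_{1..n}).
Local Open Scope ring_scope.
Import GRing.Theory.

Definition mideal E : set {mpoly K[n]} :=
  [set p | forall m, m \in msupp p -> E m].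

Lemma midealX E m : mideal E 'X_[m] <-> E m.
Proof.
split; first by apply; rewrite msuppX inE eqxx.
by move=> Em k; rewrite msuppX inE => /eqP->.
Qed.

Lemma mideal_subE E F : mideal E `<=` mideal F <-> E `<=` F.
Proof.
split=> [EF m /midealX/EF/midealX//|EF p Ep m /Ep/EF//].
Qed.

Lemma mideal_inj E F : mideal E = mideal F -> E = F.
Proof. by move=> /seteqP[EF FE]; apply/seteqP; split; apply/mideal_subE. Qed.

Lemma mideal_is_ideal E : upset E -> is_ideal (mideal E).
Proof.
move=> uE; split=> [m|p q Ep Eq m|r p Ep m].
- by rewrite -mpolyC0 msupp0.
- by move/msuppD_le; rewrite mem_cat => /orP[/Ep|/Eq].
- move/msuppM_le/allpairsP => [[u v] /= [_ /Ep Ev ->]].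
  by rewrite addmC; apply: uE.
Qed.

(** An element of [mideal E] is the sum of its terms, and each of them is a scalar
    multiple of a monomial of the ideal. *)
Lemma mideal_sub_ideal E (I : set {mpoly K[n]}) :
  is_ideal I -> (forall m, E m -> I 'X_[m]) -> mideal E `<=` I.
Proof.
move=> [I0 ID IM] EI p Ep; rewrite [p]mpolyE big_seq.
apply: (big_ind I) => // m /Ep/EI Im; rewrite -mul_mpolyC; exact: IM.
Qed.

Lemma ideal_gen_is_ideal (S : set {mpoly K[n]}) : is_ideal (ideal_gen S).
Proof.
split=> [J [[]]//|p q Sp Sq J SJ|r p Sp J SJ].
  by have [[_ JD _] _] := SJ; apply: JD; [apply: Sp|apply: Sq].
by have [[_ _ JM] _] := SJ; apply: JM; apply: Sp.
Qed.

Lemma ideal_gen_mideal A :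
  ideal_gen [set 'X_[m] | m in A] = mideal (sumset A setT).
Proof.
apply/seteqP; split.
  apply: smallest_sub; first by apply: mideal_is_ideal; apply: sumset_upset.
  by move=> _ [m Am <-]; apply/midealX; exists m => //; exists 0%MM; rewrite ?addm0.
have gI := ideal_gen_is_ideal [set 'X_[m] | m in A].
apply: mideal_sub_ideal => // _ [m Am [k _ <-]].
rewrite addmC mpolyXD; case: gI => _ _; apply.
by apply: sub_gen_smallest; exists m.
Qed.

Lemma midealM E F : upset E -> upset F ->
  ideal_mul (mideal E) (mideal F) = mideal (sumset E F).
Proof.
move=> uE uF; apply/seteqP; split.
  apply: smallest_sub; first by apply: mideal_is_ideal; apply: sumset_upset.
  move=> _ [p Ep [q Fq <-]] m /msuppM_le/allpairsP[[u v] /= [/Ep Eu /Fq Fv ->]].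
  by exists u => //; exists v.
apply: mideal_sub_ideal; first exact: ideal_gen_is_ideal.
move=> _ [x Ex [y Fy <-]]; rewrite mpolyXD; apply: sub_gen_smallest.
by exists 'X_[x]; [exact/midealX|exists 'X_[y] => //; exact/midealX].
Qed.

Lemma midealT : mideal setT = setT.
Proof. exact/seteqP. Qed.

Lemma midealXn E r : upset E -> ideal_exp (mideal E) r = mideal (nsumset E r).
Proof.
move=> uE; rewrite /ideal_exp /nsumset; elim: r => [|r IH] /=; first by rewrite midealT.
by rewrite IH midealM //; apply: nsumset_upset.
Qed.

End MonomialIdealsOfExponents.

Arguments mideal {n} K E.

(** * Two variables *)

Section TwoVariables.
Set Implicit Arguments.
Unset Strict Implicit.
Variable K : fieldType.
Implicit Types (E F A : set 'X_{1..2}) (m k : 'X_{1..2}) (I S : set {mpoly K[2]}).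
Local Open Scope ring_scope.
Import GRing.Theory.

Definition mnm2 (c d : nat) : 'X_{1..2} :=
  (U_(ord0) *+ c + U_(ord_max) *+ d)%MM.

Lemma mnm2_0 c d : mnm2 c d ord0 = c.
Proof. by rewrite mnmDE !mulmnE !mnm1E /= mul1n mul0n addn0. Qed.

Lemma mnm2_max c d : mnm2 c d ord_max = d.
Proof. by rewrite mnmDE !mulmnE !mnm1E /= mul1n mul0n. Qed.

Lemma forall_ord2 (P : 'I_2 -> Prop) : P ord0 -> P ord_max -> forall i, P i.
Proof.
move=> P0 P1 [[|[|//]] i].
  by have -> : Ordinal i = ord0 by apply: val_inj.
by have -> : Ordinal i = ord_max by apply: val_inj.
Qed.

Lemma mnm2P m k : m ord0 = k ord0 -> m ord_max = k ord_max -> m = k.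
Proof. by move=> m0 m1; apply/mnmP; apply: forall_ord2. Qed.

Lemma mnm2E m : m = mnm2 (m ord0) (m ord_max).
Proof. by apply: mnm2P; rewrite ?mnm2_0 ?mnm2_max. Qed.

Lemma mnm2_leP m k :
  (m <= k)%MM <-> (m ord0 <= k ord0)%N /\ (m ord_max <= k ord_max)%N.
Proof.
split=> [/mnm_lepP H //|[H0 H1]]; apply/mnm_lepP; exact: forall_ord2.
Qed.

Lemma monomX c d : vx K ^+ c * vy K ^+ d = 'X_[mnm2 c d].
Proof. by rewrite mpolyXD -!mpolyXn. Qed.

Lemma vxX c : vx K ^+ c = 'X_[mnm2 c 0].
Proof. by rewrite -monomX expr0 mulr1. Qed.

Lemma vyX d : vy K ^+ d = 'X_[mnm2 0 d].
Proof. by rewrite -monomX expr0 mul1r. Qed.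

Lemma sub_monomials S : S `<=` @monomials K ->
  S = [set 'X_[m] | m in [set m | S 'X_[m]]].
Proof.
move=> SM; apply/seteqP; split=> [p Sp|_ [m Sm <-] //].
by have [c [d pE]] := SM p Sp; exists (mnm2 c d); rewrite /= -monomX -pE.
Qed.

Lemma monomials_mnm A : [set 'X_[m] | m in A] `<=` @monomials K.
Proof. by move=> _ [m _ <-]; exists (m ord0), (m ord_max); rewrite monomX -mnm2E. Qed.

Lemma mideal_gens {E} A : upset E -> A `<=` E ->
  (forall m, minimal E m -> A m) -> monomial_gens (mideal K E) [set 'X_[m] | m in A].
Proof.
move=> uE AE mA; split; first exact: monomials_mnm.
rewrite ideal_gen_mideal; congr mideal; apply/seteqP; split.
  move=> m /minimal_below[k /mA Ak km]; exists k => //; exists (m - k)%MM => //.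
  by rewrite addmC submK.
by move=> _ [x /AE Ex [y _ <-]]; apply: uE.
Qed.

(** This reduces every statement about monomial ideals to upward closed sets. *)
Lemma monomial_idealP I :
  monomial_ideal I <-> exists2 E, upset E & I = mideal K E.
Proof.
split=> [[S [/sub_monomials SE ->]]|[E uE ->]].
  exists (sumset [set m | S 'X_[m]] setT); first exact: sumset_upset.
  by rewrite {1}SE ideal_gen_mideal.
by exists [set 'X_[m] | m in E]; apply: mideal_gens => // m [].
Qed.

(** A monomial generating set cannot avoid a minimal exponent: the only monomial
    of the ideal that divides it is itself. *)
Lemma minimal_sub_gens {E S m} :
  monomial_gens (mideal K E) S -> minimal E m -> S 'X_[m].
Proof.
move=> [SM]; rewrite (sub_monomials SM) ideal_gen_mideal => /mideal_inj EE [].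
rewrite EE => -[x Sx [y _ <-]] min; exists (x + y)%MM => //=.
rewrite -(min x) //; last by rewrite lem_addr.
by exists x => //; exists 0%MM; rewrite ?addm0.
Qed.

Lemma mingens_mideal E : upset E ->
  mingens (mideal K E) = [set 'X_[m] | m in minimal E].
Proof.
move=> uE; have mg : monomial_gens (mideal K E) [set 'X_[m] | m in minimal E].
  by apply: mideal_gens => // m [].
apply: xget_unique; last first.
  move=> G [gG minG]; apply/esym/minG => // _ [m Em <-]; exact: minimal_sub_gens Em.
split=> // S gS SE; apply/seteqP; split=> // _ [m Em <-].
exact: minimal_sub_gens Em.
Qed.

End TwoVariables.

(** * The class of ideals with a prescribed Newton line *)

Section Iab.
Set Implicit Arguments.
Unset Strict Implicit.
Variables (K : fieldType) (a b : nat).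
Hypotheses (a_gt0 : (0 < a)%N) (b_gt0 : (0 < b)%N).
Implicit Types (E F : set 'X_{1..2}) (m k : 'X_{1..2}).
Local Open Scope ring_scope.
Local Notation mideal := (mideal K).

Definition ea : 'X_{1..2} := mnm2 a 0.
Definition eb : 'X_{1..2} := mnm2 0 b.
(** The vertices [ea] and [eb] both have weight [a * b], which makes
    [weight m = a * b] the equation of the line through them. *)
Definition weight m : nat := (b * m ord0 + a * m ord_max)%N.

Definition Eab E : Prop :=
  [/\ upset E, E ea, E eb & forall m, E m -> (a * b <= weight m)%N].

(** The exponents of (x^a, y^b). *)
Definition Jset : set 'X_{1..2} := sumset [set ea; eb] setT.

Lemma weightD m k : weight (m + k)%MM = (weight m + weight k)%N.
Proof. by rewrite /weight !mnmDE; lia. Qed.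

Lemma weight_le m k : (m <= k)%MM -> (weight m <= weight k)%N.
Proof. by move=> /submK <-; rewrite weightD leq_addl. Qed.

Lemma weight_ea : weight ea = (a * b)%N.
Proof. by rewrite /weight mnm2_0 mnm2_max; lia. Qed.

Lemma weight_eb : weight eb = (a * b)%N.
Proof. by rewrite /weight mnm2_0 mnm2_max; lia. Qed.

(** A vertex is minimal because a proper divisor of a power of x or y lies
    strictly below the line. *)
Lemma minimal_vertex E m : Eab E -> m = ea \/ m = eb -> minimal E m.
Proof.
move=> [uE Ea Eb Ew] mE; split=> [|k /Ew wk]; first by case: mE => ->.
move: wk; rewrite /weight => wk.
by case: mE => -> /mnm2_leP; rewrite mnm2_0 mnm2_max => -[h0 h1];
  apply: mnm2P; rewrite ?mnm2_0 ?mnm2_max; nia.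
Qed.

(** The defining bound concerns the generators only; it extends to all exponents
    because the weight is monotone. *)
Lemma Iab_mideal E : upset E -> Iab a b (mideal E) <-> Eab E.
Proof.
move=> uE.
have mgX m : mingens (mideal E) 'X_[m] <-> minimal E m.
  rewrite mingens_mideal //; split=> [[k Ek XE]|Em]; last by exists m.
  suff <- : k = m by [].
  have : m \in msupp ('X_[k] : {mpoly K[2]}) by rewrite XE msuppX inE.
  by rewrite msuppX inE => /eqP.
rewrite /Iab /= vxX vyX; split=> [[_ /mgX[Ea _] /mgX[Eb _] Ew]|EE].
  split=> // m /minimal_below[k /mgX Ek /weight_le]; apply: leq_trans.
  by apply: Ew; rewrite monomX -mnm2E.
split; [by apply/monomial_idealP; exists E| | |].
- by apply/mgX; apply: minimal_vertex => //; left.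
- by apply/mgX; apply: minimal_vertex => //; right.
- move=> c d; rewrite monomX => /mgX[Ecd _].
  by case: EE => _ _ _ /(_ _ Ecd); rewrite /weight mnm2_0 mnm2_max.
Qed.

Lemma IabP I : Iab a b I <-> exists2 E, Eab E & I = mideal E.
Proof.
split=> [abI|[E EE ->]]; last by apply/Iab_mideal => //; case: EE.
have [/monomial_idealP[E uE IE] _ _ _] := abI.
by exists E => //; apply/Iab_mideal => //; rewrite -IE.
Qed.

Lemma Jab_mideal : @Jab K a b = mideal Jset.
Proof. by rewrite -ideal_gen_mideal /Jab vxX vyX image_setU !image_set1. Qed.

Lemma Jset_sub E : Eab E -> Jset `<=` E.
Proof. by move=> [uE Ea Eb _] _ [x [->|->] [y _ <-]]; apply: uE. Qed.

(** One inclusion of the reduction equation always holds, because J is contained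
    in the ideal. *)
Lemma reduction_eqP E r : Eab E ->
  reduction_eq a b (mideal E) r <->
  nsumset E r.+1 `<=` sumset [set ea; eb] (nsumset E r).
Proof.
move=> EE; have [uE Ea Eb _] := EE; have uN := @nsumset_upset _ E r.
rewrite /reduction_eq Jab_mideal !midealXn // midealM //; last exact: sumset_upset.
rewrite /Jset sumsetA sumTset //; split=> [/mideal_inj -> //|sub].
congr mideal; apply/seteqP; split=> //.
by apply: sumset_sub => // _ [->|->].
Qed.

(** I^2 = J I, read on exponents. *)
Definition sums_reduce E : Prop :=
  forall p q, E p -> E q -> sumset [set ea; eb] E (p + q)%MM.

Lemma reduction_eq1P E : Eab E -> reduction_eq a b (mideal E) 1 <-> sums_reduce E.
Proof.
move=> EE; have [uE _ _ _] := EE.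
rewrite reduction_eqP // nsumset1 // nsumset2 //.
split=> [H p q Ep Eq|H _ [p Ep [q Eq <-]]]; last exact: H.
by apply: H; exists p => //; exists q.
Qed.

Lemma reduction_eq0P E : Eab E -> reduction_eq a b (mideal E) 0 <-> E = Jset.
Proof.
move=> EE; have [uE _ _ _] := EE; rewrite reduction_eqP // nsumset1 //.
split=> [H|-> //]; apply/seteqP; split=> //; exact: Jset_sub.
Qed.

(** The multiplier [a * b] clears the denominators of the coordinates of [m] in the
    basis formed by the two vertices; these integral coordinates add up to
    [weight m]. *)
Lemma mulm_line m :
  (m *+ (a * b) = ea *+ (b * m ord0) + eb *+ (a * m ord_max))%MM.
Proof.
by apply: mnm2P; rewrite mnmDE !mulmnE ?mnm2_0 ?mnm2_max; lia.
Qed.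

(** Pigeonhole: the box has [a * b] points. *)
Lemma frequent_exponent_in_box (s : seq 'X_{1..2}) (M : nat) :
  (a * b * M < size s)%N ->
  (forall x, x \in s -> (x ord0 < a)%N /\ (x ord_max < b)%N) ->
  exists2 x, x \in s & (M < count_mem x s)%N.
Proof.
move=> ss box; apply: contrapT => nx.
suff : (size s <= a * b * M)%N by rewrite leqNgt ss.
have sz : (size (undup s) <= a * b)%N.
  rewrite -[a in (a * b)%N](size_iota 0) -[b in (_ * b)%N](size_iota 0).
  rewrite -(size_allpairs mnm2); apply: uniq_leq_size; first exact: undup_uniq.
  move=> x; rewrite mem_undup => /box[xa xb]; apply/allpairsP.
  by exists (x ord0, x ord_max) => /=; rewrite !mem_iota /= -mnm2E.
apply: (@leq_trans (size (undup s) * M)%N); last by rewrite leq_mul2r sz orbT.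
rewrite -sum1_size -big_undup_iterop_count /=.
rewrite -sum1_size big_distrl /= !big_seq; apply: leq_sum => x.
rewrite mem_undup => xs; rewrite Monoid.iteropE iter_addn addn0 mul1n mul1n leqNgt.
by apply/negP => h; apply: nx; exists x.
Qed.

(** A term above a vertex yields the vertex, while the rest of that term is
    absorbed by the sum of the other ones. *)
Lemma nsumset_split E r s t : Eab E -> (size s = r.+1) ->
  (forall x, x \in s -> E x) ->
  (exists2 x, x \in s & (ea <= x)%MM \/ (eb <= x)%MM) ->
  sumset [set ea; eb] (nsumset E r) (msum s + t)%MM.
Proof.
move=> EE sr Es [x xs ex]; rewrite (msum_perm (perm_to_rem xs)) /=.
have Er : nsumset E r (msum (rem x s)).
  have <- : size (rem x s) = r by rewrite size_rem // sr.
  by apply: nsumset_msum => y /mem_rem/Es.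
have [v [vE vx]] : exists v, (v = ea \/ v = eb) /\ (v <= x)%MM.
  by case: ex => h; [exists ea|exists eb]; split=> //; [left|right].
exists v; first exact: vE.
exists (x - v + msum (rem x s) + t)%MM.
  by apply: nsumset_upset; rewrite addmC; apply: nsumset_upset.
by rewrite !addmA [(v + _)%MM]addmC submK.
Qed.

(** The vertices span a reduction, by pigeonhole and [mulm_line]. *)
Lemma reduction_eq_exists E : Eab E -> exists r, reduction_eq a b (mideal E) r.
Proof.
move=> EE; have [uE Ea Eb Ew] := EE.
exists (a * b * (a * b))%N; apply/reduction_eqP => // m /nsumsetP[s [t [sr Es ->]]].
have [ex|nx] := pselect (exists2 x, x \in s & (ea <= x)%MM \/ (eb <= x)%MM).
  exact: nsumset_split.
have [x xs cx] : exists2 x, x \in s & (a * b < count_mem x s)%N.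
  apply: frequent_exponent_in_box => [|x xs]; first by rewrite sr.
  split; rewrite ltnNge; apply/negP => h; apply: nx; exists x => //.
    by left; apply/mnm2_leP; rewrite mnm2_0 mnm2_max.
  by right; apply/mnm2_leP; rewrite mnm2_0 mnm2_max.
(* [s'] is [s] deprived of [a * b] copies of [x]. *)
pose s' := drop (a * b) (filter (pred1 x) s) ++ filter (predC (pred1 x)) s.
have ps : perm_eq s (nseq (a * b) x ++ s').
  have -> : nseq (a * b) x = take (a * b) (filter (pred1 x) s).
    have -> : filter (pred1 x) s = nseq (count_mem x s) x.
      by rewrite -size_filter; apply/all_pred1P/filter_all.
    by rewrite take_nseq // ltnW.
  by rewrite catA cat_take_drop perm_sym perm_filterC.
have ss' : (size s' + a * b = size s)%N.
  by rewrite (perm_size ps) size_cat size_nseq addnC.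
have Es' y : y \in s' -> E y.
  by move=> ys; apply: Es; rewrite (perm_mem ps) mem_cat ys orbT.
have := Ew x (Es x xs); rewrite /weight => wx.
rewrite (msum_perm ps) msum_cat msum_nseq mulm_line.
(* The [a * b] copies of [x] are traded for at least as many vertices; after one
   copy of [v] is split off, enough terms are left. *)
have key v (i j : nat) (w : 'X_{1..2}) : v = ea \/ v = eb -> E w -> (a * b <= i.+1 + j)%N ->
   sumset [set ea; eb] (nsumset E (a * b * (a * b))) (v *+ i.+1 + w *+ j + msum s' + t)%MM.
  move=> vE Ew' ij; exists v; first exact: vE.
  have Ev : E v by case: vE => ->.
  exists (v *+ i + w *+ j + msum s' + t)%MM; last by rewrite mulmS !addmA.
  apply: nsumset_upset; apply: (@nsumset_sub _ _ (i + j + size s')); first lia.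
  by do !apply: nsumsetD; [apply: nsumsetMn|apply: nsumsetMn|apply: nsumset_msum].
case E0: (b * x ord0)%N wx => [|k] wx.
  case E1: (a * x ord_max)%N wx => [|k] wx; first by lia.
  by rewrite [(ea *+ 0 + _)%MM]addmC; apply: key => //; [right|lia].
by apply: key => //; left.
Qed.

Lemma reduction_numberP E : Eab E ->
  is_reduction_number a b (mideal E) (reduction_number a b (mideal E)).
Proof.
move=> /reduction_eq_exists[r rE].
apply: (@xgetPex _ 0%N [set r | is_reduction_number a b (mideal E) r]).
have ex : exists r, `[< reduction_eq a b (mideal E) r >] by exists r; apply/asboolP.
by exists (ex_minn ex); case: ex_minnP => m /asboolP mE min; split=> // s sE;
  apply/min/asboolP.
Qed.

Lemma reduction_number0 E : Eab E ->
  reduction_number a b (mideal E) = 0%N <-> E = Jset.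
Proof.
move=> EE; have [rE rmin] := reduction_numberP EE.
rewrite -reduction_eq0P //; split=> [r0|/rmin]; first by rewrite -[X in reduction_eq _ _ _ X]r0.
by rewrite leqn0 => /eqP.
Qed.

Lemma reduction_number1 E : Eab E ->
  reduction_number a b (mideal E) = 1%N <-> E <> Jset /\ sums_reduce E.
Proof.
move=> EE; have [rE rmin] := reduction_numberP EE.
rewrite -reduction_eq1P // -reduction_number0 //; split=> [r1|[r0 /rmin]]; last lia.
by rewrite r1 in rE *.
Qed.

(** The vertex that the members of the family subtract from [p + q] may depend on
    the member only if both vertices can be subtracted, and then either choice
    is good for all members.  The family is nonempty because the full set of
    exponents does not satisfy the bound on the weights. *)
Lemma sums_reduce_bigcap (Fam : set (set 'X_{1..2})) : Fam !=set0 ->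
  (forall E, Fam E -> Eab E /\ sums_reduce E) ->
  Eab (\bigcap_(E in Fam) E) /\ sums_reduce (\bigcap_(E in Fam) E).
Proof.
move=> [E0 FE0] H; split.
  split=> [m k Em E FE|E FE|E FE|m Em].
  - by have [[uE _ _ _] _] := H E FE; apply: uE; apply: Em.
  - by have [[]] := H E FE.
  - by have [[]] := H E FE.
  - by have [[_ _ _ Ew] _] := H E0 FE0; apply: Ew; apply: Em.
move=> p q Ep Eq.
have red E : Fam E -> exists v, (v = ea \/ v = eb) /\ ((v <= p + q)%MM /\ E (p + q - v)%MM).
  move=> FE; have [_ r1] := H E FE.
  have [v vE [y Ey <-]] := r1 p q (Ep E FE) (Eq E FE).
  by exists v; split=> //; rewrite addmC addmK lem_addl.
suff [v [vE [vpq Hv]]] : exists v, (v = ea \/ v = eb) /\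
    ((v <= p + q)%MM /\ forall E, Fam E -> E (p + q - v)%MM).
  by exists v => //; exists (p + q - v)%MM => //; rewrite addmC submK.
have [la|nla] := boolP (ea <= p + q)%MM; have [lb|nlb] := boolP (eb <= p + q)%MM.
(* Both vertices divide, so [p + q - ea] is above [eb], which every member has. *)
- exists ea; split; [by left|split=> // E /H[[uE _ Eb _] _]].
  apply: (upset_le uE Eb); move: la lb => /mnm2_leP + /mnm2_leP.
  rewrite !mnm2_0 !mnm2_max => -[h1 h2] [h3 h4].
  by apply/mnm2_leP; rewrite !mnmBE !mnm2_0 !mnm2_max subn0.
- exists ea; split; [by left|split=> // E /red[v [[->|->] []//]]].
  by rewrite (negPf nlb).
- exists eb; split; [by right|split=> // E /red[v [[->|->] []//]]].
  by rewrite (negPf nla).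
- have [v [[->|->] []]] := red E0 FE0; first by rewrite (negPf nla).
  by rewrite (negPf nlb).
Qed.

(** Subtracting a vertex from the sum of two points above the line leaves a point
    above the line, so only the signs of the coordinates matter: if the first
    coordinate is less than [a], then the weights force the second one to be at
    least [b]. *)
Lemma sums_reduce_halfplane :
  Eab [set m | (a * b <= weight m)%N] /\ sums_reduce [set m | (a * b <= weight m)%N].
Proof.
split.
  split=> [m k /= h||| //]; first by rewrite weightD; apply: leq_trans (leq_addr _ _).
  - by rewrite /= weight_ea.
  - by rewrite /= weight_eb.
move=> p q /= hp hq.
suff [v [vE wv vpq]] : exists v, [/\ (v = ea \/ v = eb), weight v = (a * b)%N & (v <= p + q)%MM].
  exists v => //; exists (p + q - v)%MM; last by rewrite addmC submK.
  by move: (weightD (p + q - v) v)%MM; rewrite submK //= weightD wv; lia.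
have [la|nla] := leqP a (p ord0 + q ord0)%N.
  exists ea; rewrite weight_ea; split=> //; first by left.
  by apply/mnm2_leP; rewrite mnm2_0 mnm2_max mnmDE.
exists eb; rewrite weight_eb; split=> //; first by right.
apply/mnm2_leP; rewrite mnm2_0 mnm2_max mnmDE; split=> //.
rewrite mnmDE; move: hp hq; rewrite /weight; nia.
Qed.

End Iab.

(** * Intersections of ideals of reduction number one *)

Theorem corollary6p2 (K : fieldType) (a b : nat) (I : set {mpoly K[2]})
    (ha : (1 < a)%N) (hab : (a <= b)%N)
    (hI : Iab a b I) (hIJ : I <> Jab a b) :
  (forall L1 L2 : set {mpoly K[2]},
      Iab a b L1 -> Iab a b L2 ->
      I `<=` L1 -> I `<=` L2 ->
      reduction_number a b L1 = 1%N -> reduction_number a b L2 = 1%N ->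
      reduction_number a b (L1 `&` L2) = 1%N)
  /\
  (exists! L : set {mpoly K[2]},
      [/\ Iab a b L, I `<=` L, reduction_number a b L = 1%N &
          forall L' : set {mpoly K[2]},
            monomial_ideal L' -> I `<=` L' -> L' `<` L ->
            (1 < reduction_number a b L')%N]).
Proof.
have a0 : (0 < a)%N := ltnW ha; have b0 : (0 < b)%N := leq_trans a0 hab.
move: hI hIJ => /(IabP a0 b0)[E0 EE0 ->] hIJ.
(* [Jset] is contained in [E0], so that equality with a larger set would force
   I = J. *)
have nJ E : E0 `<=` E -> E <> Jset a b.
  move=> EE EJ; apply: hIJ; rewrite Jab_mideal; congr mideal; apply/seteqP; split.
    by rewrite -EJ.
  exact: Jset_sub.
split.
  move=> L1 L2 /(IabP a0 b0)[E1 EE1 ->] /(IabP a0 b0)[E2 EE2 ->].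
  move=> /mideal_subE s1 /mideal_subE s2.
  move=> /(reduction_number1 K a0 b0 EE1)[_ r1] /(reduction_number1 K a0 b0 EE2)[_ r2].
  have -> : mideal K E1 `&` mideal K E2 = mideal K (\bigcap_(E in [set E1; E2]) E).
    rewrite bigcap_setU !bigcap_set1; apply/seteqP.
    by split=> [p [p1 p2] m mp|p H]; [split; [apply: p1|apply: p2]|
      split=> m /H[]].
  have [] := @sums_reduce_bigcap a b [set E1; E2].
  - by exists E1; left.
  - by move=> E [->|->].
  move=> EL rL; apply/(reduction_number1 K a0 b0 EL); split=> //.
  by apply: nJ => m Em E [->|->]; [apply: s1|apply: s2].
(* The intersection of this family is the ideal sought in (b). *)
pose Fam := [set E | [/\ Eab a b E, E0 `<=` E & sums_reduce a b E]].
have [] := @sums_reduce_bigcap a b Fam.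
- have [hE hr] := sums_reduce_halfplane a0 b0.
  exists [set m | (a * b <= weight a b m)%N]; split=> //.
  by case: EE0.
- by move=> E [].
set EL := \bigcap_(E in Fam) E => abL rL.
have E0L : E0 `<=` EL by move=> m Em E [_ + _]; apply.
have minL L : Iab a b L -> mideal K E0 `<=` L -> reduction_number a b L = 1%N ->
    mideal K EL `<=` L.
  move=> /(IabP a0 b0)[E abE ->] /mideal_subE sE /(reduction_number1 K a0 b0 abE)[_ rE].
  by apply/mideal_subE => m; apply; split.
have [uL _ _ wL] := abL.
exists (mideal K EL); split; first split.
- by apply/IabP => //; exists EL.
- exact/mideal_subE.
- by apply/(reduction_number1 K a0 b0 abL); split=> //; apply: nJ.
- move=> L' /monomial_idealP[E uE ->] /mideal_subE sE [/mideal_subE EsL nLE].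
  have abE : Eab a b E.
    by have [_ Ea Eb _] := EE0; split=> //; [apply: sE|apply: sE|move=> m /EsL/wL].
  have r0 : reduction_number a b (mideal K E) <> 0%N.
    by move=> /(reduction_number0 K a0 b0 abE); apply: nJ.
  have r1 : reduction_number a b (mideal K E) <> 1%N.
    by move=> r1; apply: nLE; apply: minL => //; [apply/IabP => //; exists E|apply/mideal_subE].
  lia.
move=> L [abL' sL rL' minL']; apply: contrapT => neq.
have sub := minL L abL' sL rL'.
have := minL' (mideal K EL); rewrite (_ : reduction_number a b (mideal K EL) = 1%N).
  apply: contraPP => // _; rewrite ltnn => H; suff: false by [].
  apply: H; [by apply/monomial_idealP; exists EL|exact/mideal_subE|].
  by split=> // sub'; apply: neq; apply/seteqP.
by apply/(reduction_number1 K a0 b0 abL); split=> //; apply: nJ.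
Qed.
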